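(* Let $1\le r\le n$, let $p=(p_1,\dots,p_n)$ be a size vector with $p_1\le p_2\le\cdots\le p_n$, and let $A,B\subseteq S_p$ be an $r$-cross-intersecting pair of families. (1) If $p_1>r+1$, then $|A|\cdot|B|\le\prod_{i=r+1}^n p_i^2$; in case of equality $A=B$ and this family is obtained by fixing $r$ coordinates (i.e. it equals $\{x\in S_p: x_i=a_i \text{ for all } i\in R\}$ for some $R\subseteq[n]$ with $|R|=r$ and some $a_i\in[p_i]$). (2) If $p_1=r+1>4$, then $|A|\cdot|B|\le\prod_{i=r+1}^n p_i^2$; in case of equality $A=B$ and this family is either obtained by fixing $r$ coordinates, or is a Hamming ball of radius $1$ in a set $T$ of $r+2$ coordinates all satisfying $p_i=r+1$ ($i\in T$). (3) There is a function $t$ with $t(r)=r/2+o(r)$ such that if $p_1\ge t(r)$ and $(A,B)$ is a maximal $r$-cross-intersecting pair, then $A$ and $B$ are Hamming balls in some set of at most $r+3$ coordinates.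
   Context: $[m]=\{1,\dots,m\}$. A size vector is a sequence of integers $p=(p_1,\dots,p_n)$ with $p_i\ge 2$ for all $i$; $S_p=[p_1]\times\cdots\times[p_n]$. Two vectors $x,y\in S_p$ are $r$-intersecting if $|\{i: x_i=y_i\}|\ge r$; families $A,B\subseteq S_p$ are $r$-cross-intersecting if every $x\in A$, $y\in B$ are $r$-intersecting. A pair $(A,B)$ of $r$-cross-intersecting families in $S_p$ is maximal if it maximizes $|A|\cdot|B|$ among all $r$-cross-intersecting pairs in $S_p$. For $T\subseteq[n]$, $x_0\in S_p$ and $0\le k\le|T|$, the Hamming ball of radius $k$ around $x_0$ in the coordinates $T$ is $\{x\in S_p: |\{i\in T: x_i\ne (x_0)_i\}|\le k\}$. *)

(* Defs.v *)
From HB Require Import structures.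
From mathcomp Require Import all_boot all_order all_algebra.
Set Implicit Arguments. Unset Strict Implicit. Unset Printing Implicit Defensive.
Import Order.TTheory GRing.Theory Num.Theory.

(* A size vector p = (p_1,...,p_n) is a seq nat of length n; coordinate i
   (0-indexed, i : 'I_(size p)) takes values in 'I_(p`_i) ~ [p_i]. *)
Definition size_vector (p : seq nat) : bool := all (fun a => 2 <= a) p.

Definition Sp (p : seq nat) := {dffun forall i : 'I_(size p), 'I_(nth 0 p i)}.

Definition agree (p : seq nat) (x y : Sp p) : {set 'I_(size p)} :=
  [set i | x i == y i].

Definition r_intersecting (p : seq nat) (r : nat) (x y : Sp p) : Prop :=
  r <= #|agree x y|.

Definition r_cross_intersecting (p : seq nat) (r : nat) (A B : {set Sp p}) : Prop :=
  forall x y, x \in A -> y \in B -> r_intersecting r x y.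

Definition maximal_pair (p : seq nat) (r : nat) (A B : {set Sp p}) : Prop :=
  r_cross_intersecting r A B /\
  forall A' B' : {set Sp p}, r_cross_intersecting r A' B' ->
    #|A'| * #|B'| <= #|A| * #|B|.

Definition hamming_ball (p : seq nat) (x0 : Sp p) (T : {set 'I_(size p)}) (k : nat)
  : {set Sp p} :=
  [set x : Sp p | #|[set i in T | x i != x0 i]| <= k].

Definition fixes_coords (p : seq nat) (r : nat) (F : {set Sp p}) : Prop :=
  exists (R : {set 'I_(size p)}) (a : Sp p),
    #|R| = r /\ F = [set x : Sp p | [forall i in R, x i == a i]].

(* prod_{i=r+1}^n p_i^2  (0-indexed: i = r .. n-1) *)
Definition bound (r : nat) (p : seq nat) : nat :=
  \prod_(r <= i < size p) (nth 0 p i) ^ 2.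

(* Main.v *)
Require Import Defs.
From HB Require Import structures.
From mathcomp Require Import all_boot all_order all_algebra.
From mathcomp Require Import zify ring.
Import Order.TTheory GRing.Theory Num.Theory.
Set Implicit Arguments. Unset Strict Implicit. Unset Printing Implicit Defensive.

(* Let (A, B) be a maximal pair. Comparing it with the cylinders over its slices
   x_i = l shows that a coordinate i either does not matter for A and B, or has
   a value c_i such that at most |A|/p_i elements of A and |B|/p_i elements of B
   have x_i <> c_i. Let T be the set of coordinates of the second kind. By
   Markov's inequality many elements of A differ from c in at most one (or no)
   coordinate of a subset of T; as |A||B| is at least the product obtained by
   fixing r coordinates, this gives |T| <= r when p_1 >= r + 2, and |T| <= r + 2
   when 2 p_1 >= r + 7 or p_1 = r + 1 >= 5. Since elements of A and B differ in
   at most |T| - r coordinates of T, an element of A differing from c in that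
   many coordinates of T forces B to be constant on T, by the same averaging; so
   for |T| <= r + 2 both families are Hamming balls. *)

(** * Vectors *)

Lemma subset_of_card (I : finType) (T : {set I}) (k : nat) :
  k <= #|T| -> exists2 R : {set I}, R \subset T & #|R| = k.
Proof.
move=> kT; exists [set x in take k (enum T)].
  by apply/subsetP=> x; rewrite inE => /mem_take; rewrite mem_enum.
rewrite cardsE; have /card_uniqP-> := take_uniq k (enum_uniq T).
by rewrite size_takel // -cardE.
Qed.

Lemma card_setD1 (I : finType) (T : {set I}) (j : I) (k : nat) :
  j \in T -> #|T| = k.+1 -> #|T :\ j| = k.
Proof. by move=> jT; rewrite (cardsD1 j) jT => -[]. Qed.

Section Coordinates.
Variable p : seq nat.
Local Notation n := (size p).
Local Notation P i := (nth 0 p i).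
Implicit Types (i j : 'I_n) (T R : {set 'I_n}) (x y c : Sp p) (A B : {set Sp p}).

Definition fix_on T c : {set Sp p} := [set x : Sp p | [forall i in T, x i == c i]].
Definition supp T c x : {set 'I_n} := [set i in T | x i != c i].
Definition upd x i (v : 'I_(P i)) : Sp p := finfun (dfwith x v).
Definition splice T x y : Sp p := finfun (fun i => if i \in T then x i else y i).

Lemma upd_in x i (v : 'I_(P i)) : upd x v i = v.
Proof. by rewrite ffunE dfwith_in. Qed.

Lemma upd_out x i (v : 'I_(P i)) j : j != i -> upd x v j = x j.
Proof. by move=> ij; rewrite ffunE dfwith_out // eq_sym. Qed.

Lemma spliceE T x y i : splice T x y i = if i \in T then x i else y i.
Proof. by rewrite ffunE. Qed.

Lemma eq_updP x y i : (forall j, j != i -> x j = y j) -> y = upd x (y i).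
Proof.
move=> xy; apply/ffunP=> j; have [->|ji] := eqVneq j i; first by rewrite upd_in.
by rewrite upd_out // xy.
Qed.

Lemma fix_onP T c x : reflect (forall i, i \in T -> x i = c i) (x \in fix_on T c).
Proof.
rewrite inE; apply: (iffP forall_inP) => [h i /h /eqP|h i /h ->] //.
Qed.

Lemma supp0P T c x : (supp T c x == set0) = (x \in fix_on T c).
Proof.
apply/eqP/fix_onP => [s0 i iT|xc].
  by apply/eqP; move/setP/(_ i): s0; rewrite !inE iT /=; case: eqP.
by apply/setP=> i; rewrite !inE; apply/negP=> /andP[/xc ->]; rewrite eqxx.
Qed.

Lemma card_fix_on T c : #|fix_on T c| = \prod_(i | i \notin T) P i.
Proof.
pose G i : {set 'I_(P i)} := if i \in T then [set c i] else setT.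
have -> : fix_on T c = setXn G.
  apply/setP=> x; apply/fix_onP/setXnP => h i.
    by rewrite /G; case: ifP => [/h ->|]; rewrite inE.
  by move=> iT; have := h i; rewrite /G iT inE => /eqP.
rewrite cardsXn [RHS]big_mkcond; apply: eq_bigr => i _; rewrite /G.
by case: ifP => _; rewrite ?cards1 // cardsT card_ord.
Qed.

Lemma card_supp1 T c i : i \in T ->
  #|[set x in fix_on (T :\ i) c | x i != c i]| = (P i).-1 * \prod_(j | j \notin T) P j.
Proof.
move=> iT; pose G j : {set 'I_(P j)} :=
  if j == i then [set~ c j] else if j \in T then [set c j] else setT.
have -> : [set x in fix_on (T :\ i) c | x i != c i] = setXn G.
  apply/setP=> x; rewrite inE; apply/andP/setXnP => [[/fix_onP h xi] j|h].
    rewrite /G; case: eqP => [->|/eqP ji]; first by rewrite !inE.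
    by case: ifP => [jT|]; rewrite inE // h // !inE ji.
  split; last by have := h i; rewrite /G eqxx !inE.
  apply/fix_onP=> j; rewrite !inE => /andP[ji jT].
  by have := h j; rewrite /G (negPf ji) jT inE => /eqP.
rewrite cardsXn (bigD1 i) //= {1}/G eqxx cardsC1 card_ord; congr (_ * _).
rewrite [LHS]big_mkcond [RHS]big_mkcond; apply: eq_bigr => j _; rewrite /G.
have [->|ji] := eqVneq j i; first by rewrite iT.
by case: ifP => _ /=; rewrite ?cards1 // cardsT card_ord.
Qed.

(** A support of size at most one is empty or some [{i}], and [{i}] is the support of [(P i).-1]
    vectors for each choice of the coordinates outside [T]. *)
Lemma card_supp_le1 T c :
  #|[set x | #|supp T c x| <= 1]| <=
  (\prod_(i | i \notin T) P i) * (1 + \sum_(i in T) (P i).-1).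
Proof.
apply: (@leq_trans #|fix_on T c :|:
  \bigcup_(i in T) [set x in fix_on (T :\ i) c | x i != c i]|).
  apply/subset_leq_card/subsetP=> x; rewrite inE => s1; rewrite inE -supp0P.
  have [//|[i]] := set_0Vmem (supp T c x); first by move->; rewrite eqxx.
  move=> is0; apply/orP; right; apply/bigcupP.
  have := is0; rewrite inE => /andP[iT xi]; exists i => //; rewrite inE xi andbT.
  apply/fix_onP=> j; rewrite !inE => /andP[ji jT]; apply/eqP/negPn/negP => xj.
  have js : j \in supp T c x by rewrite inE jT.
  by move: ji; rewrite (card_le1_eqP s1 _ _ is0 js) eqxx.
apply: (leq_trans (leq_card_setU _ _)); rewrite mulnDr muln1 card_fix_on leq_add2l.
rewrite big_distrr /=.
apply: (@leq_trans (\sum_(i in T) #|[set x in fix_on (T :\ i) c | x i != c i]|)).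
  by elim/big_rec2: _ => [|i a b _ h]; rewrite ?cards0 //
    (leq_trans (leq_card_setU _ _)) // leq_add2l.
by apply/eq_leq/eq_bigr => i iT; rewrite card_supp1 // mulnC.
Qed.

End Coordinates.

(** * Maximal pairs *)

(** In the application [a], [b] are the sizes of the families, [u], [w] count the elements with
    [x_i = l], and [s], [t] the others. If [A] deviates relatively at least as often, then
    [u / a <= w / b], whence [q ^ 2 * s * u <= q.-1 * a ^ 2]. As [s + u = a], both [q * s] and
    [q * u] cannot exceed [a]. *)
Lemma bias_arith_half (q a s u b w t : nat) :
  a = u + s -> b = w + t -> 0 < b -> a < q * u -> t * u <= s * w ->
  q ^ 2 * (s * w) <= q.-1 * (a * b) -> q * s <= a.
Proof.
move=> ea eb b0 qu tu h; rewrite leqNgt; apply/negP=> qs.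
have q0 : 0 < q by case: q qs {qu h}.
have h1 : u * b <= a * w by rewrite ea eb !mulnDr !mulnDl leq_add2l mulnC.
have h2 : q ^ 2 * (s * u) <= q.-1 * (a * a).
  rewrite -(leq_pmul2r b0).
  apply: (@leq_trans (q ^ 2 * (s * w) * a)); last by nia.
  rewrite -mulnA -[X in _ <= X]mulnA leq_pmul2l ?expn_gt0 ?q0 // -!mulnA.
  by rewrite leq_mul2l (mulnC w) h1 orbT.
have : (q * s - a) * (q * u - a) > 0 by rewrite muln_gt0 !subn_gt0 qs.
have := h2; case: q q0 qs qu {h h2} => // q _ /=; nia.
Qed.

(** The family with the larger relative deviation falls under [bias_arith_half]; the other one
    deviates even less. *)
Lemma bias_arith (q a s u b t w : nat) :
  a = u + s -> b = w + t -> 0 < a -> 0 < b -> a < q * u -> b < q * w ->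
  q ^ 2 * (u * t) <= q.-1 * (a * b) -> q ^ 2 * (s * w) <= q.-1 * (a * b) ->
  q * s <= a /\ q * t <= b.
Proof.
move=> ea eb a0 b0 qu qw h1 h2; case: (leqP (t * u) (s * w)) => [le|/ltnW le].
  have qs : q * s <= a by apply: (bias_arith_half ea eb b0 qu le h2).
  split=> //; rewrite -(leq_pmul2r a0).
  have : t * a <= s * b by nia.
  nia.
have qt : q * t <= b.
  by apply: (bias_arith_half eb ea a0 qw) => //; rewrite (mulnC b) (mulnC t).
split=> //; rewrite -(leq_pmul2r b0).
have : s * b <= t * a by nia.
nia.
Qed.

Section MaximalPairs.
Variable p : seq nat.
Local Notation n := (size p).
Local Notation P i := (nth 0 p i).
Implicit Types (i j : 'I_n) (T R : {set 'I_n}) (x y c : Sp p) (A B : {set Sp p}).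

Definition depends_on T A :=
  forall x y, x \in A -> (forall i, i \in T -> x i = y i) -> y \in A.

(** One coordinate is changed at a time, by induction on the number of places where [x] and [y]
    differ. *)
Lemma depends_onP T A :
  (forall i, i \notin T -> forall x, x \in A -> forall v : 'I_(P i), upd x v \in A) ->
  depends_on T A.
Proof.
move=> h x y; have [k] := ubnP #|[set i | x i != y i]|.
elim: k x => // k IH x; rewrite ltnS => xyk xA xy.
have [s0|[i]] := set_0Vmem [set i | x i != y i].
  suff -> : y = x by [].
  by apply/ffunP=> i; move/setP/(_ i): s0; rewrite !inE; case: eqP.
rewrite inE => xyi; have iT : i \notin T by apply: contra xyi => /xy ->.
apply: (IH (upd x (y i))) => [||j jT].
- apply: (leq_trans _ xyk); apply: proper_card; apply/properP; split.
    apply/subsetP=> j; rewrite !inE; have [->|ji] := eqVneq j i; first by rewrite upd_in eqxx.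
    by rewrite upd_out.
  by exists i; rewrite inE // upd_in eqxx.
- exact: h.
- have ji : j != i by apply: contraNneq iT => <-.
  by rewrite upd_out // xy.
Qed.

Lemma r_cross_sym r A B : r_cross_intersecting r A B -> r_cross_intersecting r B A.
Proof.
move=> h x y xB yA; rewrite /r_intersecting; have -> : agree x y = agree y x.
  by apply/setP=> i; rewrite !inE eq_sym.
exact: h.
Qed.

Lemma maximal_sym r A B : maximal_pair r A B -> maximal_pair r B A.
Proof.
move=> [h1 h2]; split=> [|A' B' h]; first exact: r_cross_sym.
by rewrite mulnC (mulnC #|B|) h2 //; apply: r_cross_sym.
Qed.

Lemma maximal_exists r : exists A B : {set Sp p}, maximal_pair r A B.
Proof.
pose cr (AB : {set Sp p} * {set Sp p}) :=
  [forall x in AB.1, forall y in AB.2, r <= #|agree x y|].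
have crP AB : reflect (r_cross_intersecting r AB.1 AB.2) (cr AB).
  apply: (iffP forall_inP) => h x.
    by move=> y xA yB; have /forall_inP := h x xA; apply.
  by move=> xA; apply/forall_inP=> y yB; apply: h.
have cr0 : cr (set0, set0) by apply/crP=> x y; rewrite inE.
have [[A B] /crP hAB hm] := @arg_maxnP _ (set0, set0) cr (fun AB => #|AB.1| * #|AB.2|) cr0.
by exists A, B; split=> // A' B' /(crP (A', B')) /hm.
Qed.

Lemma maximal_mem r A B x : maximal_pair r A B -> 0 < #|B| ->
  (forall y, y \in B -> r_intersecting r x y) -> x \in A.
Proof.
move=> [hc hm] B0 hx; apply: contraT => xA.
have /hm : r_cross_intersecting r (x |: A) B.
  by move=> z y /setU1P[->|zA] yB; [apply: hx | apply: hc].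
by rewrite cardsU1 xA leq_pmul2r // ltnn.
Qed.

Hypothesis Ppos : forall i, 0 < P i.

Lemma maximal_lower r A B R : maximal_pair r A B -> #|R| = r ->
  (\prod_(i | i \notin R) P i) ^ 2 <= #|A| * #|B|.
Proof.
move=> [_ hm] Rr; pose c : Sp p := finfun (fun i => Ordinal (Ppos i)).
rewrite -(card_fix_on R c) -mulnn; apply: hm => x y /fix_onP xc /fix_onP yc.
rewrite /r_intersecting -Rr; apply/subset_leq_card/subsetP=> i iR.
by rewrite inE xc // yc.
Qed.

Lemma maximal_gt0 r A B : r <= n -> maximal_pair r A B -> 0 < #|A| /\ 0 < #|B|.
Proof.
move=> rn hm; have [|R _ Rr] := @subset_of_card _ [set: 'I_n] r.
  by rewrite cardsT card_ord.
apply/andP; rewrite -muln_gt0; apply: leq_trans (maximal_lower hm Rr).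
by rewrite expn_gt0 prodn_cond_gt0.
Qed.

Definition slice A i (l : 'I_(P i)) := [set x in A | x i == l].
Definition cyl A i (l : 'I_(P i)) := [set x | upd x l \in A].

Lemma card_slices A i : #|A| = \sum_(l : 'I_(P i)) #|slice A l|.
Proof.
rewrite -sum1_card (partition_big (fun x : Sp p => x i) predT) //=.
by apply: eq_bigr => l _; rewrite -sum1_card; apply: eq_bigl => x; rewrite inE.
Qed.

Lemma card_cyl A i (l : 'I_(P i)) : #|cyl A l| = P i * #|slice A l|.
Proof.
rewrite (card_slices (cyl A l) i).
transitivity (\sum_(v : 'I_(P i)) #|slice A l|); last by rewrite sum_nat_const card_ord.
apply: eq_bigr => v _.
have inj : {in slice (cyl A l) v &, injective (fun x => upd x l)}.
  move=> x y; rewrite !inE => /andP[_ /eqP xv] /andP[_ /eqP yv] e.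
  apply/ffunP=> j; have [->|ji] := eqVneq j i; first by rewrite xv yv.
  by rewrite -(upd_out x l ji) e upd_out.
rewrite -(card_in_imset inj); apply: eq_card => z; rewrite inE; apply/imsetP/andP.
  by move=> [x]; rewrite !inE => /andP[xA _] ->; rewrite upd_in eqxx.
move=> [zA /eqP zl]; exists (upd z v); last first.
  rewrite -zl; apply: eq_updP => j ji; by rewrite upd_out.
rewrite !inE upd_in eqxx andbT.
suff -> : upd (upd z v) l = z by [].
by rewrite -zl; apply/esym/eq_updP => j ji; rewrite upd_out.
Qed.

(** Overwriting coordinate [i] by values from disjoint sets destroys any agreement there, so the
    agreements of the overwritten vectors lie at coordinates that [x] and [y] keep. *)
Lemma cyl_cross r A B i (L M : {set 'I_(P i)}) :
  r_cross_intersecting r A B -> [disjoint L & M] ->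
  r_cross_intersecting r (\bigcup_(l in L) cyl A l) (\bigcup_(m in M) cyl B m).
Proof.
move=> h dLM x y /bigcupP[l lL]; rewrite inE => xA /bigcupP[m mM]; rewrite inE => yB.
apply: leq_trans (h _ _ xA yB) _; apply/subset_leq_card/subsetP=> j.
rewrite !inE; have [->|ji] := eqVneq j i; last by rewrite !upd_out.
by rewrite !upd_in => /eqP e; have := disjointFr dLM lL; rewrite e mM.
Qed.

Lemma slice_compl A i (l : 'I_(P i)) :
  #|A| = #|slice A l| + #|[set x in A | x i != l]|.
Proof.
rewrite -(cardsID [set x : Sp p | x i == l] A); congr (_ + _); apply: eq_card => x.
  by rewrite !inE.
by rewrite !inE andbC.
Qed.

(** The competing pair is [cyl A l] and [U], the union of the cylinders of [B] over all other
    values. [U] is at least as large as each of these [(P i).-1] cylinders, hence as their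
    average. *)
Lemma slice_product r A B i (l : 'I_(P i)) : maximal_pair r A B -> 
  P i ^ 2 * (#|slice A l| * #|[set x in B | x i != l]|) <= (P i).-1 * (#|A| * #|B|).
Proof.
move=> [hc hm]; set U := \bigcup_(m in [set~ l]) cyl B m.
have dl : [disjoint [set l] & [set~ l]] by rewrite disjoints_subset setCK subxx.
have := cyl_cross hc dl; rewrite big_set1 -/U => /hm hU.
have {}hU : P i * (#|slice A l| * #|U|) <= #|A| * #|B| by rewrite mulnA -card_cyl.
suff hB : P i * #|[set x in B | x i != l]| <= (P i).-1 * #|U|.
  rewrite expnS expn1 (mulnC #|slice A l|) mulnA -[P i * P i * _]mulnA -mulnA.
  apply: (@leq_trans (P i * ((P i).-1 * #|U| * #|slice A l|))).
    by rewrite leq_mul2l leq_mul2r hB !orbT.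
  by rewrite -mulnA mulnCA leq_mul2l (mulnC #|U|) hU orbT.
have e : [set x in B | x i != l] = \bigcup_(m in [set~ l]) slice B m.
  apply/setP=> x; rewrite inE; apply/andP/bigcupP => [[xB xl]|[m]].
    by exists (x i); rewrite !inE ?xB ?eqxx.
  by rewrite !inE => ml /andP[xB /eqP ->].
have le : #|[set x in B | x i != l]| <= \sum_(m in [set~ l]) #|slice B m|.
  rewrite e; elim/big_rec2: _ => [|m a b _ h]; first by rewrite cards0.
  by apply: (leq_trans (leq_card_setU _ _)); rewrite leq_add2l.
apply: (@leq_trans (\sum_(m in [set~ l]) #|cyl B m|)).
  under eq_bigr => m _ do rewrite card_cyl.
  by rewrite -big_distrr /= leq_mul2l le orbT.
have -> : (P i).-1 = #|[set~ l]| by rewrite cardsC1 card_ord.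
rewrite -sum_nat_const; apply: leq_sum => m hm'.
by apply/subset_leq_card/bigcup_sup.
Qed.

Lemma slice_mul r A B i (l m : 'I_(P i)) : maximal_pair r A B -> l != m ->
  P i ^ 2 * (#|slice A l| * #|slice B m|) <= #|A| * #|B|.
Proof.
move=> [hc hm] lm; have dl : [disjoint [set l] & [set m]].
  by rewrite disjoints1 inE.
have := cyl_cross hc dl; rewrite !big_set1 => /hm.
by rewrite !card_cyl mulnACA mulnn.
Qed.

(* If all slices have equal size then every pair [cyl A l], [cyl B m] with
   [l != m] is again maximal, so [cyl A l] is determined by [cyl B m] and
   hence, a third value [m] being available, independent of [l]. *)
Lemma equal_slices_irrelevant r A B i : maximal_pair r A B -> 2 < P i ->
  0 < #|A| -> 0 < #|B| ->
  (forall l : 'I_(P i), P i * #|slice A l| = #|A|) ->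
  (forall l : 'I_(P i), P i * #|slice B l| = #|B|) ->
  forall x, x \in A -> forall v : 'I_(P i), upd x v \in A.
Proof.
move=> [hc hm] P3 A0 B0 eA eB x xA v.
have [m [mx mv]] : exists m : 'I_(P i), m != x i /\ m != v.
  have /card_gt0P[m] : 0 < #|~: [set x i; v]|.
    rewrite cardsCs setCK card_ord subn_gt0; apply: leq_ltn_trans P3.
    by rewrite cards2; case: eqP.
  by rewrite !inE negb_or => /andP[]; exists m.
have mp (l : 'I_(P i)) : m != l -> maximal_pair r (cyl A l) (cyl B m).
  move=> ml; split; last by move=> A' B' /hm; rewrite !card_cyl eA eB.
  have dl : [disjoint [set l] & [set m]] by rewrite disjoints1 inE eq_sym.
  by have := cyl_cross hc dl; rewrite !big_set1.
suff : x \in cyl A v by rewrite inE.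
apply: (maximal_mem (mp _ mv)); first by rewrite card_cyl eB.
case: (mp _ mx) => hc' _ y; apply: hc'; rewrite inE.
by suff <- : x = upd x (x i) by []; apply: eq_updP.
Qed.

(** If some slice of [A] exceeds the average, [slice_mul] keeps the slices of [B] at other values
    below average, so both families favour the same [l] and [bias_arith] applies. Otherwise all
    slices of [A] are equal, and [slice_mul] makes those of [B] equal too. *)
Lemma bias_dichotomy r A B i : maximal_pair r A B -> 2 < P i ->
  0 < #|A| -> 0 < #|B| ->
  (forall x, x \in A -> forall v : 'I_(P i), upd x v \in A) /\
  (forall x, x \in B -> forall v : 'I_(P i), upd x v \in B) \/
  exists l : 'I_(P i), P i * #|[set x in A | x i != l]| <= #|A| /\
                       P i * #|[set x in B | x i != l]| <= #|B|.
Proof.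
move=> hm P3 A0 B0; have hm' := maximal_sym hm.
have sumP C : \sum_(l : 'I_(P i)) P i * #|slice C l| = \sum_(l : 'I_(P i)) #|C|.
  by rewrite -big_distrr /= -card_slices sum_nat_const card_ord.
have [/existsP[l hl]|/existsPn hn] := boolP [exists l : 'I_(P i), #|A| < P i * #|slice A l|].
  right; exists l; have small m : m != l -> P i * #|slice B m| < #|B|.
    move=> ml; have := slice_mul hm (_ : l != m); rewrite eq_sym => /(_ ml) h.
    rewrite ltnNge; apply/negP=> h'; move: h; rewrite leqNgt => /negP; apply.
    have -> : P i ^ 2 * (#|slice A l| * #|slice B m|) =
      (P i * #|slice A l|) * (P i * #|slice B m|) by rewrite mulnACA mulnn.
    by apply: (@leq_trans (P i * #|slice A l| * #|B|));
      rewrite ?ltn_pmul2r // leq_mul2l h' orbT.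
  have big : #|B| < P i * #|slice B l|.
    rewrite ltnNge; apply/negP=> h.
    have := sumP B; apply/eqP; rewrite neq_ltn; apply/orP; left.
    have /card_gt0P[m] : 0 < #|~: [set l]| by rewrite cardsC1 card_ord; lia.
    rewrite !inE => ml; rewrite (bigD1 m) //= [X in _ < X](bigD1 m) //= -addSn.
    apply: leq_add; first exact: small.
    by apply: leq_sum => k _; have [->|/small/ltnW] := eqVneq k l.
  apply: (bias_arith (slice_compl A l) (slice_compl B l)) => //.
    exact: slice_product hm.
  by have := slice_product l hm'; rewrite (mulnC #|B|) (mulnC #|slice B l|).
left.
have tight C : (forall l : 'I_(P i), P i * #|slice C l| <= #|C|) ->
    forall l : 'I_(P i), P i * #|slice C l| = #|C|.
  move=> h l; apply/eqP; rewrite eqn_leq h /=; have := sumP C.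
  rewrite (bigD1 l) //= [X in _ = X](bigD1 l) //= => e.
  have : \sum_(k | k != l) P i * #|slice C k| <= \sum_(k : 'I_(P i) | k != l) #|C|.
    by apply: leq_sum => k _; apply: h.
  by rewrite -(leq_add2l (P i * #|slice C l|)) e leq_add2r.
have eA : forall l : 'I_(P i), P i * #|slice A l| = #|A|.
  by apply: tight => l; rewrite leqNgt hn.
have eB : forall l : 'I_(P i), P i * #|slice B l| = #|B|.
  apply: tight => m; have /card_gt0P[l] : 0 < #|~: [set m]|.
    by rewrite cardsC1 card_ord; lia.
  rewrite !inE => lm; have := slice_mul hm lm.
  by rewrite -[P i ^ 2]mulnn mulnACA eA leq_pmul2l.
split; first exact: equal_slices_irrelevant hm _ _ _ _ _.
exact: equal_slices_irrelevant hm' _ _ _ _ _.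
Qed.

End MaximalPairs.

(** * Biased coordinates and Hamming balls *)

Section BiasedCoordinates.
Variable p : seq nat.
Local Notation n := (size p).
Local Notation P i := (nth 0 p i).
Implicit Types (i j : 'I_n) (T R : {set 'I_n}) (x y c : Sp p) (A B : {set Sp p}).

Definition biased A T c :=
  forall i, i \in T -> P i * #|[set x in A | x i != c i]| <= #|A|.

Lemma biasedS A T R c : R \subset T -> biased A T c -> biased A R c.
Proof. by move=> /subsetP RT h i /RT /h. Qed.

Lemma maximal_structure r A B : r <= n -> (forall i, 2 < P i) -> maximal_pair r A B ->
  exists T c, [/\ biased A T c, biased B T c, depends_on T A & depends_on T B].
Proof.
move=> rn P3 hm.
have [A0 B0] := maximal_gt0 (fun i => ltnW (ltnW (P3 i))) rn hm.
pose good i (l : 'I_(P i)) := (P i * #|[set x in A | x i != l]| <= #|A|)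
                           && (P i * #|[set x in B | x i != l]| <= #|B|).
have /card_gt0P[x0 _] := A0.
(* [x0] only fills in the coordinates outside [T], where no value is good. *)
pose c : Sp p := finfun (fun i => odflt (x0 i) [pick l | good i l]).
pose T := [set i | [exists l, good i l]].
have cT i : i \in T -> good i (c i).
  rewrite inE ffunE => /existsP[l gl]; case: pickP => //= /(_ l).
  by rewrite gl.
have irr i : i \notin T ->
    (forall x, x \in A -> forall v : 'I_(P i), upd x v \in A) /\
    (forall x, x \in B -> forall v : 'I_(P i), upd x v \in B).
  rewrite inE => /existsPn iT.
  case: (bias_dichotomy hm (P3 i) A0 B0) => // -[l [h1 h2]].
  by have := iT l; rewrite /good h1 h2.
exists T, c; split=> [i /cT/andP[]|i /cT/andP[]||] //.
  by apply: depends_onP => i /irr[].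
by apply: depends_onP => i /irr[].
Qed.

(** Outside [T], [x] can be overwritten by values avoiding [y] without leaving [A]; at least [r]
    agreements remain, all of them in [T]. *)
Lemma cross_on r A B T : (forall i, 1 < P i) -> r_cross_intersecting r A B ->
  depends_on T A -> forall x y, x \in A -> y \in B -> r + #|supp T x y| <= #|T|.
Proof.
move=> P2 hc hd x y xA yB.
pose z : Sp p := finfun (fun i => odflt (y i) [pick v | v != y i]).
have zy i : z i != y i.
  rewrite ffunE; case: pickP => //= h.
  have : 0 < #|[set~ y i]| by rewrite cardsC1 card_ord -subn1 subn_gt0.
  by case/card_gt0P=> v; rewrite !inE h.
have mA : splice T x z \in A by apply: (hd x) => // i iT; rewrite spliceE iT.
rewrite addnC -leq_subRL; last by apply/subset_leq_card/subsetP=> i; rewrite inE => /andP[].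
rewrite -cardsDS; last by apply/subsetP=> i; rewrite inE => /andP[].
apply: leq_trans (hc _ _ mA yB) _; apply/subset_leq_card/subsetP=> i.
rewrite !inE spliceE; case: ifP => iT.
  by move=> /eqP ->; rewrite eqxx.
by rewrite (negPf (zy i)).
Qed.

Lemma supp_sum A T c :
  \sum_(x in A) #|supp T c x| = \sum_(i in T) #|[set x in A | x i != c i]|.
Proof.
transitivity (\sum_(x in A) \sum_(i in T) (x i != c i : nat)).
  apply: eq_bigr => x _; rewrite -sum1_card big_mkcond [RHS]big_mkcond.
  by apply: eq_bigr => i _; rewrite inE; case: (i \in T); case: (x i != c i).
rewrite exchange_big; apply: eq_bigr => i _.
rewrite -sum1_card big_mkcond [RHS]big_mkcond.
by apply: eq_bigr => x _; rewrite inE; case: (x \in A); case: (x i != c i).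
Qed.

Lemma biased_sum A T c q : biased A T c -> (forall i, i \in T -> q <= P i) ->
  q * (\sum_(x in A) #|supp T c x|) <= #|T| * #|A|.
Proof.
move=> hb hq; rewrite supp_sum big_distrr /= -sum_nat_const; apply: leq_sum => i iT.
by apply: leq_trans (hb i iT); rewrite leq_mul2r hq ?orbT.
Qed.

(** Markov's inequality cleared of denominators: the supports have average size at most [#|T| / q]
    over [A], so at most a fraction [#|T| / (k.+1 * q)] of them has size above [k]. *)
Lemma biased_markov A T c q k : biased A T c -> (forall i, i \in T -> q <= P i) ->
  k.+1 * q * #|A| <=
  k.+1 * q * #|[set x in A | #|supp T c x| <= k]| + #|T| * #|A|.
Proof.
move=> hb hq; apply: (@leq_trans (k.+1 * q * #|[set x in A | #|supp T c x| <= k]| +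
                    q * (\sum_(x in A) #|supp T c x|))); last first.
  by rewrite leq_add2l; apply: biased_sum.
rewrite -(cardsID [set x | #|supp T c x| <= k] A) mulnDr.
have -> : A :&: [set x | #|supp T c x| <= k] = [set x in A | #|supp T c x| <= k].
  by apply/setP=> x; rewrite !inE.
rewrite leq_add2l mulnAC mulnC leq_mul2l; apply/orP; right.
rewrite mulnC -sum_nat_const.
rewrite big_mkcond [X in _ <= X]big_mkcond; apply: leq_sum => x _.
by rewrite !inE -ltnNge andbC; case: (x \in A) => //=; case: ltnP.
Qed.

Lemma fix_on_sub T c A : depends_on T A -> forall x, x \in A -> x \in fix_on T c ->
  fix_on T c \subset A.
Proof.
move=> hd x xA /fix_onP xc; apply/subsetP=> y /fix_onP yc.
by apply: (hd x) => // i iT; rewrite xc // yc.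
Qed.

Lemma hamming_ball0 c T : hamming_ball c T 0 = fix_on T c.
Proof. by apply/setP=> x; rewrite inE leqn0 cards_eq0 -supp0P. Qed.

(** Vectors within distances [l] and [k] of [c] on [T] agree in at least [#|T| - (k + l)]
    coordinates, so [maximal_mem] applies. *)
Lemma ball_sub r A B T c k l : maximal_pair r A B -> 0 < #|B| ->
  r + (k + l) <= #|T| -> B \subset hamming_ball c T k -> hamming_ball c T l \subset A.
Proof.
move=> hm B0 hT /subsetP hB; apply/subsetP=> x; rewrite inE => xl.
apply: (maximal_mem hm B0) => y /hB; rewrite inE => yk.
rewrite /r_intersecting; apply: (@leq_trans #|T :\: (supp T c x :|: supp T c y)|).
  have := (leq_card_setU (supp T c x) (supp T c y)).1.
  have := cardsID (supp T c x :|: supp T c y) T.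
  have := subset_leq_card (subsetIr T (supp T c x :|: supp T c y)).
  rewrite -!/(supp T c _) in xl yk; lia.
apply/subset_leq_card/subsetP=> i; rewrite !inE; case: (i \in T); rewrite ?andbF //=.
by rewrite andbT negb_or !negbK => /andP[/eqP -> /eqP ->].
Qed.

Lemma fix_on_ball r A B T c d : (forall i, 1 < P i) -> maximal_pair r A B -> 0 < #|B| ->
  depends_on T A -> depends_on T B -> #|T| = r + d -> B \subset fix_on T c ->
  A = hamming_ball c T d /\ B = hamming_ball c T 0.
Proof.
move=> P2 hm B0 dA dB Td sB; have eB : B = hamming_ball c T 0.
  rewrite hamming_ball0; apply/eqP; rewrite eqEsubset sB /=.
  by have /card_gt0P[y yB] := B0; apply: fix_on_sub yB (subsetP sB _ yB).
split=> //; apply/eqP; rewrite eqEsubset andbC.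
rewrite (ball_sub (k := 0) hm B0) -?eB ?Td //=.
have cB : c \in B by rewrite eB hamming_ball0; apply/fix_onP.
apply/subsetP=> x xA; rewrite inE -(leq_add2l r) -Td.
have := cross_on P2 (r_cross_sym (proj1 hm)) dB cB xA; exact.
Qed.

(** Let [S] be the support of [x]. Where [y] in [B] agrees with [c] on [S], it differs from [x], so
    [#|S| <= d + #|supp S c y|]. Averaging over [B] gives [#|S| <= d + #|S| / q], which excludes
    [#|S| > d] when [d.+1 < q]. *)
Lemma supp_bound r A B T c q d : (forall i, 1 < P i) -> maximal_pair r A B -> 0 < #|B| ->
  depends_on T A -> biased B T c -> (forall i, i \in T -> q <= P i) ->
  #|T| = r + d -> d.+1 < q -> forall x, x \in A -> #|supp T c x| <= d.
Proof.
move=> P2 [hc _] B0 dA bB hq Td dq x xA; set S := supp T c x.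
have ST : S \subset T by apply/subsetP=> i; rewrite inE => /andP[].
have qS i : i \in S -> q <= P i by move/(subsetP ST)/hq.
have h1 : #|S| * #|B| <= d * #|B| + \sum_(y in B) #|supp S c y|.
  rewrite -!(mulnC #|B|) -!sum_nat_const -big_split /=; apply: leq_sum => y yB.
  have := cross_on P2 hc dA xA yB; rewrite Td leq_add2l => xy.
  rewrite -(cardsID (supp S c y) S) addnC leq_add //; last first.
    by apply/subset_leq_card/subsetIr.
  apply: leq_trans xy; apply/subset_leq_card/subsetP=> i; rewrite !inE.
  case: (i \in T) => //=; case: eqP => //= xi; rewrite ?andbT ?andbF // negbK.
  by move=> /eqP ->; apply/eqP=> e; apply: xi.
have h2 := biased_sum (biasedS ST bB) qS.
rewrite leqNgt; apply/negP => dS.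
have h3 : q * #|S| <= q * d + #|S|.
  by rewrite -(leq_pmul2r B0) mulnDl -!mulnA; nia.
nia.
Qed.

(** An element of [B] equal to [c] on the support [S] of [x] uses up all [d] disagreements with [x]
    there, so on the rest of [T] it equals [x] and hence [c]. By Markov such elements make up more
    than [1 / q] of [B]. *)
Lemma full_supp r A B T c q d : (forall i, 1 < P i) -> maximal_pair r A B -> 0 < #|B| ->
  depends_on T A -> depends_on T B -> biased B T c -> (forall i, i \in T -> q <= P i) ->
  #|T| = r + d -> d.+1 < q -> (exists2 x, x \in A & #|supp T c x| = d) ->
  B \subset fix_on T c.
Proof.
move=> P2 [hc _] B0 dA dB bB hq Td dq [x xA xd]; set S := supp T c x in xd.
have ST : S \subset T by apply/subsetP=> i; rewrite inE => /andP[].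
have qS i : i \in S -> q <= P i by move/(subsetP ST)/hq.
have h0 : [set y in B | #|supp S c y| <= 0] \subset fix_on T c.
  apply/subsetP=> y; rewrite inE leqn0 cards_eq0 supp0P => /andP[yB /fix_onP ys].
  have := cross_on P2 hc dA xA yB; rewrite Td leq_add2l => xy.
  have Sxy : S = supp T x y.
    apply/eqP; rewrite eqEcard xd xy andbT; apply/subsetP=> i iS.
    by rewrite inE (subsetP ST) //= ys //; move: iS; rewrite inE eq_sym => /andP[].
  apply/fix_onP=> i iT; have [/ys//|iS] := boolP (i \in S).
  have := iS; rewrite {1}Sxy !inE iT /= negbK => /eqP ->.
  by move: iS; rewrite inE iT /= negbK => /eqP.
have := biased_markov 0 (biasedS ST bB) qS; rewrite mul1n xd => h1.
apply/negPn/negP=> /subsetPn[y yB]; rewrite -supp0P => /set0Pn[k].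
rewrite inE => /andP[kT yk].
(* All of [fix_on T y] lies in [B] and deviates at [k]. It is as large as [fix_on T c], whose size
   is then at most [#|B| / q] by bias. *)
have : #|fix_on T c| <= #|[set z in B | z k != c k]|.
  rewrite card_fix_on -(card_fix_on T y); apply/subset_leq_card/subsetP=> z /fix_onP zy.
  rewrite inE zy // yk andbT; apply: (dB y) => // i iT.
  by rewrite zy.
move=> le_fix; have : q * #|[set y in B | #|supp S c y| <= 0]| <= #|B|.
  apply: leq_trans (bB k kT); apply: leq_mul; first exact: hq.
  exact: leq_trans (subset_leq_card h0) le_fix.
nia.
Qed.

(** If neither family lies in [fix_on T c], [full_supp] keeps all supports below [d]. This is absurd
    for [d <= 1]; for [d = 2] both families lie in balls of radius 1, which [ball_sub] fills. *)
Lemma ball_structure r A B T c q d : (forall i, 1 < P i) -> maximal_pair r A B ->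
  0 < #|A| -> 0 < #|B| -> depends_on T A -> depends_on T B ->
  biased A T c -> biased B T c -> (forall i, i \in T -> q <= P i) ->
  #|T| = r + d -> d <= 2 -> d.+1 < q ->
  [\/ A = hamming_ball c T d /\ B = hamming_ball c T 0,
      A = hamming_ball c T 0 /\ B = hamming_ball c T d |
      [/\ d = 2, A = hamming_ball c T 1 & B = hamming_ball c T 1]].
Proof.
move=> P2 hm A0 B0 dA dB bA bB hq Td d2 dq; have hm' := maximal_sym hm.
have [sB|sB] := boolP (B \subset fix_on T c).
  by apply: Or31; apply: fix_on_ball hm B0 dA dB Td sB.
have [sA|sA] := boolP (A \subset fix_on T c).
  by apply: Or32; have [-> ->] := fix_on_ball P2 hm' A0 dB dA Td sA.
have lt C D : maximal_pair r C D -> 0 < #|D| -> depends_on T C -> depends_on T D ->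
    biased D T c -> ~~ (D \subset fix_on T c) -> forall x, x \in C -> #|supp T c x| < d.
  move=> hm1 D0 dC dD bD sD x xC; rewrite ltn_neqAle.
  rewrite (supp_bound P2 hm1 D0 dC bD hq Td dq xC) andbT.
  by apply: contra sD => /eqP e; apply: (full_supp P2 hm1 D0 dC dD bD hq Td dq); exists x.
have ltA := lt _ _ hm B0 dA dB bB sB; have ltB := lt _ _ hm' A0 dB dA bA sA.
have sub (C : {set Sp p}) : (forall x, x \in C -> #|supp T c x| < d) ->
    C \subset hamming_ball c T d.-1.
  by move=> h; apply/subsetP=> x /h; rewrite inE; case: (d).
case: d d2 sub Td {dq lt} ltA ltB => [|[|[|//]]] _ sub Td ltA ltB.
- by have /card_gt0P[x /ltA] := A0.
- by case/negP: sA; rewrite -hamming_ball0; apply: sub.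
apply: Or33; split=> //; apply/eqP; rewrite eqEsubset sub //=.
  by apply: (ball_sub (k := 1) hm B0); rewrite ?Td //; apply: sub.
by apply: (ball_sub (k := 1) hm' A0); rewrite ?Td //; apply: sub.
Qed.

End BiasedCoordinates.

(** * Bounding the number of relevant coordinates *)

Section RelevantCoordinates.
Variable p : seq nat.
Local Notation n := (size p).
Local Notation P i := (nth 0 p i).
Implicit Types (i j : 'I_n) (T R : {set 'I_n}) (x y c : Sp p) (A B : {set Sp p}).

Lemma prod_outside T R : R \subset T ->
  \prod_(i | i \notin R) P i = \prod_(i in T :\: R) P i * \prod_(i | i \notin T) P i.
Proof.
move=> /subsetP RT; rewrite (bigID (mem T)) /=; congr (_ * _); apply: eq_bigl => i.
  by rewrite inE.
by case: (boolP (i \in T)) => iT; rewrite ?andbF // andbT; apply: contra iT; apply: RT.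
Qed.

Lemma sum_pred_le T M : (forall i, i \in T -> P i <= M) ->
  \sum_(i in T) (P i).-1 <= #|T| * M.-1.
Proof.
by move=> hM; rewrite -sum_nat_const; apply: leq_sum => i /hM; lia.
Qed.

(** Markov's inequality for [k = 1]: at least a fraction [1 - #|T| / (2 * q)] of [A] lies in the
    ball of radius 1, bounded by [card_supp_le1]. *)
Lemma biased_upper A T c q M : biased A T c ->
  (forall i, i \in T -> q <= P i <= M) ->
  (2 * q - #|T|) * #|A| <= 2 * q * ((\prod_(i | i \notin T) P i) * (1 + #|T| * M.-1)).
Proof.
move=> bA hq; rewrite mulnBl leq_subLR addnC.
apply: leq_trans (biased_markov 1 bA (fun i iT => proj1 (andP (hq i iT)))) _.
rewrite leq_add2r leq_mul2l; apply/orP; right.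
apply: (@leq_trans #|[set x | #|supp T c x| <= 1]|).
  by apply/subset_leq_card/subsetP=> x; rewrite !inE => /andP[].
apply: leq_trans (card_supp_le1 _ _) _; rewrite leq_mul2l leq_add2l.
by rewrite sum_pred_le ?orbT // => i /hq/andP[].
Qed.

Hypothesis Ppos : forall i, 0 < P i.

Lemma prod_outside_gt0 T : 0 < \prod_(i | i \notin T) P i.
Proof. by rewrite prodn_cond_gt0. Qed.

(** The competing pair fixes [r] coordinates of [T :\ j]. Against [biased_upper], [j] is chosen to
    maximize [P], so that [P j] serves as [M]. *)
Lemma lower_on r A B T j q d : maximal_pair r A B -> #|T| = r + d.+1 -> j \in T ->
  (forall i, i \in T -> q <= P i) ->
  ((\prod_(i | i \notin T) P i) * (P j * q ^ d)) ^ 2 <= #|A| * #|B|.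
Proof.
move=> hm Td jT hq; have [|R RT Rr] := @subset_of_card _ (T :\ j) r.
  by rewrite (card_setD1 jT (etrans Td (addnS r d))) leq_addr.
apply: leq_trans (maximal_lower Ppos hm Rr); rewrite leq_exp2r //.
have RT' : R \subset T by apply: subset_trans RT (subD1set _ _).
have jR : j \in T :\: R.
  by rewrite inE jT andbT; apply/negP=> /(subsetP RT); rewrite !inE eqxx.
rewrite (prod_outside RT') mulnC leq_mul2r; apply/orP; right.
rewrite (big_setD1 j jR) /= leq_mul2l; apply/orP; right.
have <- : #|(T :\: R) :\ j| = d.
  by apply: card_setD1 jR _; rewrite cardsDS // Td Rr addKn.
rewrite -prod_nat_const; apply: leq_prod => i; rewrite !inE => /and3P[_ _ /hq] //.
Qed.

Lemma sq_lower (x a b : nat) : x ^ 2 <= a * b -> x <= a \/ x <= b.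
Proof. by rewrite -mulnn; case: (leqP x a); [left | right; nia]. Qed.

Lemma sq_tight (x a b : nat) : x ^ 2 <= a * b -> a <= x -> b <= x -> a = x /\ b = x.
Proof. by rewrite -mulnn => h ax bx; split; nia. Qed.

(** For [S] of [r + 3] coordinates, [P j] largest on [S] and [F] the product of [P] outside [S],
    some family has at least [F * P j * q ^ 2] elements, while [biased_upper] bounds
    [2 * q - (r + 3)] times its size strictly by [2 * q * F * (r + 3) * P j]. *)
Lemma few_relevant r A B T c q : maximal_pair r A B ->
  biased A T c -> biased B T c -> (forall i, q <= P i) ->
  2 * (r + 3) <= (2 * q - (r + 3)) * q -> #|T| <= r + 2.
Proof.
move=> hm bA bB hq num; rewrite leqNgt; apply/negP=> Tr.
have [|S ST Sr] := @subset_of_card _ T (r + 3); first by rewrite addnS.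
have [j0 j0S] : exists j, j \in S by apply/card_gt0P; rewrite Sr addnS.
have [j jS hj] := arg_maxnP (fun i => P i) j0S.
have hqS i : i \in S -> q <= P i <= P j by move=> /hj ij; rewrite hq.
have lo := lower_on hm (Sr : _ = r + 2.+1) jS (fun i _ => hq i).
have F0 := prod_outside_gt0 S; set F := \prod_(i | _) _ in lo F0 *.
suff no C : biased C S c -> F * (P j * q ^ 2) <= #|C| -> False.
  by case: (sq_lower lo); apply: no; [exact: (biasedS ST bA) | exact: (biasedS ST bB)].
move=> bC loC; have := biased_upper bC hqS; rewrite -/F Sr.
apply/negP; rewrite -ltnNge; have q0 : 0 < q.
  by rewrite lt0n; apply: contraTneq num => ->; rewrite muln0 addnS.
have {loC} h : (2 * q - (r + 3)) * (F * (P j * q ^ 2)) <= (2 * q - (r + 3)) * #|C|.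
  by rewrite leq_mul2l loC orbT.
apply: leq_trans h; have -> : (2 * q - (r + 3)) * (F * (P j * q ^ 2)) =
  ((2 * q - (r + 3)) * q) * (q * F * P j) by ring.
apply: (@leq_trans (2 * (r + 3) * (q * F * P j))); last by rewrite leq_mul2r num orbT.
have -> : 2 * q * (F * (1 + (r + 3) * (P j).-1)) = (2 * q * F) * (1 + (r + 3) * (P j).-1) by ring.
have -> : 2 * (r + 3) * (q * F * P j) = (2 * q * F) * ((r + 3) * P j) by ring.
rewrite ltn_pmul2l ?muln_gt0 ?q0 ?F0 //; have := Ppos j; nia.
Qed.

(* Here the upper bounds [q #|fix_on S c|] on [#|A|] and [#|B|] given by Markov's
   inequality multiply exactly to the lower bound of [lower_on]. *)
Lemma tight_core r A B S c q : maximal_pair r A B -> 0 < #|A| -> 0 < #|B| ->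
  biased A S c -> biased B S c -> (forall i, q <= P i) -> r.+2 <= q -> #|S| = r.+1 ->
  [/\ q = r.+2, fix_on S c \subset A, fix_on S c \subset B,
      #|A| = q * #|fix_on S c| & #|B| = q * #|fix_on S c|].
Proof.
move=> hm A0 B0 bA bB hq rq Sr.
have [j jS] : exists j, j \in S by apply/card_gt0P; rewrite Sr.
have lo := lower_on hm (etrans Sr (esym (addn1 r)) : #|S| = r + 1) jS (fun i _ => hq i).
rewrite expn0 muln1 -(card_fix_on S c) in lo.
have F0 : 0 < #|fix_on S c| by rewrite card_fix_on prod_outside_gt0.
have core C : biased C S c ->
    q * #|C| <= q * #|C :&: fix_on S c| + r.+1 * #|C|.
  move=> bC; have := biased_markov 0 bC (fun i _ => hq i); rewrite mul1n Sr.
  suff -> : [set x in C | #|supp S c x| <= 0] = C :&: fix_on S c by [].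
  by apply/setP=> x; rewrite !inE leqn0 cards_eq0 supp0P inE.
have coreF C : biased C S c -> #|C| <= q * #|fix_on S c|.
  move=> /core; have := subset_leq_card (subsetIr C (fix_on S c)); nia.
have qPj := hq j.
have {}lo : (q * #|fix_on S c|) ^ 2 <= #|A| * #|B|.
  by apply: leq_trans lo; rewrite leq_exp2r // mulnC leq_mul2l qPj orbT.
have [eA eB] := sq_tight lo (coreF A bA) (coreF B bB).
have eq : q = r.+2.
  apply/eqP; rewrite eqn_leq rq andbT -(leq_pmul2r A0).
  apply: leq_trans (core A bA) _; rewrite [r.+2 * _]mulSn leq_add2r eA.
  by rewrite leq_mul2l subset_leq_card ?subsetIr ?orbT.
have full C : biased C S c -> #|C| = q * #|fix_on S c| -> fix_on S c \subset C.
  move=> /core h e; apply/setIidPr/eqP; rewrite eqEcard subsetIr /=.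
  move: h; rewrite [X in X * _ <= _]eq [r.+2 * _]mulSn leq_add2r e.
  by rewrite leq_pmul2l // eq.
by split=> //; apply: full.
Qed.

(** If [#|T| > r], [tight_core] applies to every [r.+1]-subset [S] of [T]: both families contain
    [fix_on S c], so no element deviates from [c] twice on [S]. Counting deviations then gives a
    contradiction, whether [S] is all of [T] or not. *)
Lemma tight_bound r A B T c q : (forall i, 1 < P i) ->
  maximal_pair r A B -> 0 < r -> 0 < #|A| -> 0 < #|B| ->
  depends_on T A -> depends_on T B ->
  biased A T c -> biased B T c -> (forall i, q <= P i) -> r.+2 <= q -> #|T| <= r.
Proof.
move=> P2 hm r0 A0 B0 dA dB bA bB hq rq; rewrite leqNgt; apply/negP=> Tr.
have tight (S : {set 'I_n}) : S \subset T -> #|S| = r.+1 ->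
  [/\ q = r.+2, fix_on S c \subset A, fix_on S c \subset B,
      #|A| = q * #|fix_on S c| & #|B| = q * #|fix_on S c|].
  by move=> ST; apply: tight_core hm A0 B0 (biasedS ST bA) (biasedS ST bB) hq rq.
have dS (S : {set 'I_n}) : depends_on S (fix_on S c).
  by move=> x y /fix_onP xc xy; apply/fix_onP=> i iS; rewrite -xy // xc.
have supp1 (S : {set 'I_n}) (C D : {set Sp p}) : r_cross_intersecting r C D ->
    fix_on S c \subset D -> #|S| = r.+1 ->
    forall x, x \in C -> #|supp S c x| <= 1.
  move=> hc sD Sr x xC; have cc : c \in fix_on S c by apply/fix_onP.
  have hc' : r_cross_intersecting r (fix_on S c) C.
    by move=> y z yc zC; apply: (r_cross_sym hc) => //; apply: (subsetP sD).
  have := cross_on P2 hc' (dS S) cc xC; rewrite Sr; lia.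
(* The [r.+1 * #|fix_on S c|] elements of [C] outside [fix_on S c] deviate once each on [S], and by
   bias each of the [r.+1] coordinates accounts for at most [#|fix_on S c|] of them; so every bound
   is attained. *)
have count (S : {set 'I_n}) (C : {set Sp p}) : #|S| = r.+1 -> q = r.+2 -> fix_on S c \subset C ->
    (forall x, x \in C -> #|supp S c x| <= 1) -> #|C| = q * #|fix_on S c| ->
    biased C S c -> forall i, i \in S -> #|[set x in C | x i != c i]| = #|fix_on S c|.
  move=> Sr eq sC h1 eC bC i iS.
  have le k : k \in S -> #|[set x in C | x k != c k]| <= #|fix_on S c|.
    by move=> kS; have := bC k kS; rewrite eC; have := hq k; nia.
  have : \sum_(x in C) #|supp S c x| = #|C :\: fix_on S c|.
    rewrite -sum1_card big_mkcond [RHS]big_mkcond; apply: eq_bigr => x _.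
    rewrite inE; case: (boolP (x \in C)) => xC; rewrite ?andbF // andbT.
    have := h1 x xC; rewrite -supp0P -cards_eq0; case: (#|_|) => [|[|]] //.
  rewrite supp_sum cardsDS // eC (big_setD1 i iS) eq mulSn addKn mulSn /= => hs.
  have : \sum_(k in S :\ i) #|[set x in C | x k != c k]| <= r * #|fix_on S c|.
    have <- : #|S :\ i| = r by rewrite (card_setD1 iS Sr).
    by rewrite -sum_nat_const; apply: leq_sum => k; rewrite inE => /andP[_ /le].
  have squeeze (u v w z : nat) : u + v = w + z -> v <= z -> u <= w -> u = w by lia.
  by move=> hr; apply: squeeze hs hr (le i iS).
have [S ST Sr] := subset_of_card Tr.
have [eq sA sB eA eB] := tight S ST Sr.
have F0 : 0 < #|fix_on S c| by rewrite card_fix_on prod_outside_gt0.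
have hc := proj1 hm; have hc' := r_cross_sym hc.
have other i : i \in S -> exists2 k, k \in S & k != i.
  move=> iS; have /card_gt0P[k] : 0 < #|S :\ i|.
    by rewrite (card_setD1 iS Sr).
  by rewrite !inE => /andP[ki kS]; exists k.
(* If [S = T], an [x] in [A] deviating only at [i] and a [y] in [B] deviating only at [j] differ
   twice on [T], where one difference is allowed. *)
have [eTS|neTS] := eqVneq S T.
  have [i iS] : exists i, i \in S by apply/card_gt0P; rewrite Sr.
  have [j jS ji] := other i iS.
  have cA := count S A Sr eq sA (supp1 _ _ _ hc sB Sr) eA (biasedS ST bA) i iS.
  have cB := count S B Sr eq sB (supp1 _ _ _ hc' sA Sr) eB (biasedS ST bB) j jS.
  have /card_gt0P[x] : 0 < #|[set x in A | x i != c i]| by rewrite cA.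
  have /card_gt0P[y] : 0 < #|[set y in B | y j != c j]| by rewrite cB.
  rewrite !inE => /andP[yB yj] /andP[xA xi].
  have xj : x j = c j.
    apply/eqP/negPn/negP => xj; have /card_le1_eqP h := supp1 _ _ _ hc sB Sr x xA.
    by move/eqP: ji; apply; apply: h; rewrite inE ?iS ?jS.
  have yi : y i = c i.
    apply/eqP/negPn/negP => yi; have /card_le1_eqP h := supp1 _ _ _ hc' sA Sr y yB.
    by move/eqP: ji; apply; apply: h; rewrite inE ?iS ?jS.
  have := cross_on P2 hc dA xA yB; rewrite -eTS Sr -addn1 leq_add2l => /card_le1_eqP h.
  by move/eqP: ji; apply; apply: h; rewrite inE ?iS ?jS /= ?yi ?xj // eq_sym.
(* Otherwise a coordinate of [S] is exchanged for [t]. By [count], exactly [#|fix_on S c|] elements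
   of [A] deviate at [t]; but they deviate nowhere on [S], so they lie in [fix_on S c] and miss its
   element [c]. *)
have [t tT tS] : exists2 t, t \in T & t \notin S.
  by apply/subsetPn; apply: contra neTS => TS; rewrite eqEsubset ST.
have swap k : k \in S -> t |: (S :\ k) \subset T /\ #|t |: (S :\ k)| = r.+1.
  move=> kS; split.
    by rewrite subUset sub1set tT; apply: subset_trans (subD1set _ _) ST.
  rewrite cardsU1 !inE (negPf tS) andbF /=.
  by rewrite (card_setD1 kS Sr).
have [k kS] : exists i, i \in S by apply/card_gt0P; rewrite Sr.
have [S2T S2r] := swap k kS; have [_ s2A s2B e2A _] := tight _ S2T S2r.
have := count _ _ S2r eq s2A (supp1 _ _ _ hc s2B S2r) e2A (biasedS S2T bA) t (setU11 _ _).
have -> : #|fix_on (t |: S :\ k) c| = #|fix_on S c|.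
  by apply/eqP; rewrite -(eqn_pmul2l (_ : 0 < q)) -?e2A -?eA // eq.
apply/eqP; rewrite neq_ltn; apply/orP; left; apply: proper_card.
apply/properP; split; last first.
  by exists c; [apply/fix_onP | rewrite !inE eqxx andbF].
apply/subsetP=> x; rewrite inE => /andP[xA xt]; apply/fix_onP=> i iS.
apply/eqP/negPn/negP => xi; have [l lS li] := other i iS.
(* Dropping [l] keeps both [i] and [t] in the subset, on which [x] deviates at most once. *)
have [S3T S3r] := swap l lS; have [_ _ s3B _ _] := tight _ S3T S3r.
have /card_le1_eqP h := supp1 _ _ _ hc s3B S3r x xA.
move/negP: tS; apply; suff <- : i = t by [].
have il : i != l by rewrite eq_sym.
by apply: h; rewrite !inE ?eqxx ?xt // iS xi il orbT.
Qed.

Lemma cross_fixed r A B T : (forall i, 1 < P i) -> r_cross_intersecting r A B ->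
  0 < #|A| -> 0 < #|B| -> depends_on T A -> depends_on T B -> #|T| <= r ->
  #|T| = r /\ exists c, A = fix_on T c /\ B = fix_on T c.
Proof.
move=> P2 hc /card_gt0P[a aA] /card_gt0P[b bB] dA dB Tr.
have key x y : x \in A -> y \in B -> #|T| = r /\ y \in fix_on T x.
  move=> xA yB; have := cross_on P2 hc dA xA yB.
  rewrite -supp0P -cards_eq0; split; lia.
have [eT bfix] := key a b aA bB; split=> //; exists a; split.
  apply/setP=> x; apply/idP/idP => [xA|]; last first.
    by move/fix_onP=> h; apply: (dA a) => // i /h.
  apply/fix_onP=> i iT; have [_ /fix_onP h1] := key x b xA bB.
  by rewrite -h1 //; move/fix_onP: bfix; apply.
apply/setP=> y; apply/idP/idP => [yB|]; first by have [] := key a y aA yB.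
by apply: (subsetP (fix_on_sub dB bB bfix)).
Qed.

End RelevantCoordinates.

(** * Extremal pairs *)

Section ExtremalPairs.
Variable p : seq nat.
Local Notation n := (size p).
Local Notation P i := (nth 0 p i).
Implicit Types (i j : 'I_n) (T R : {set 'I_n}) (x y c : Sp p) (A B : {set Sp p}).

Lemma card_initial r : r <= n -> #|[set i : 'I_n | i < r]| = r.
Proof.
move=> rn; rewrite -sum1_card -[RHS](card_ord r) -sum1_card.
rewrite (big_ord_widen _ (fun _ => 1) rn); apply: eq_bigl => i.
by rewrite inE.
Qed.

Lemma bound_sq r :
  bound r p = (\prod_(i | i \notin [set i : 'I_n | i < r]) P i) ^ 2.
Proof.
rewrite /bound big_geq_mkord (big_morph (fun a => a ^ 2) (fun a b => expnMn a b 2) (exp1n 2)).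
by apply: eq_bigl => i; rewrite inE -leqNgt.
Qed.

Lemma sorted_nth_le i j : sorted leq p -> i <= j -> P i <= P j.
Proof.
by move=> sp ij; apply: (sorted_leq_nth leq_trans leqnn) => //; rewrite inE ltn_ord.
Qed.

(** For [I] the first [r] coordinates, [I :\: R] and [R :\: I] have equal size, and the [r]-th entry
    of [p] separates the entries on the former from those on the latter. *)
Lemma prod_outside_sq_le r R : sorted leq p -> 0 < r -> #|R| = r ->
  (\prod_(i | i \notin R) P i) ^ 2 <= bound r p.
Proof.
move=> sp r0 Rr; have rn : r <= n by rewrite -Rr -[X in _ <= X]card_ord max_card.
rewrite bound_sq leq_exp2r //; set I := [set i : 'I_n | i < r].
have Ir : #|I| = r by apply: card_initial.
have eI : #|I :\: R| = #|R :\: I| by rewrite !cardsD Ir Rr setIC.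
have split_prod (U V : {set 'I_n}) : \prod_(i | i \notin U) P i =
    \prod_(i in V :\: U) P i * \prod_(i | (i \notin U) && (i \notin V)) P i.
  rewrite (bigID (mem V)) /=; congr (_ * _); apply: eq_bigl => i.
  by rewrite inE.
rewrite (split_prod R I) (split_prod I R).
have -> : \prod_(i | (i \notin I) && (i \notin R)) P i =
          \prod_(i | (i \notin R) && (i \notin I)) P i.
  by apply: eq_bigl => i; rewrite andbC.
rewrite leq_mul2r; apply/orP; right.
have hr : r.-1 < n by rewrite prednK.
pose k : 'I_n := Ordinal hr.
apply: (@leq_trans (P k ^ #|I :\: R|)).
  rewrite -prod_nat_const; apply: leq_prod => i; rewrite !inE => /andP[_ ir].
  by apply: sorted_nth_le => //=; lia.
rewrite eI -prod_nat_const; apply: leq_prod => i; rewrite !inE => /andP[ir _].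
by apply: sorted_nth_le => //=; lia.
Qed.

(** A maximal pair exists, so its bound holds for all pairs, and a pair attaining the bound is
    itself maximal. *)
Lemma reduce_to_maximal r (Q : {set Sp p} -> {set Sp p} -> Prop) :
  (forall i, 0 < P i) -> r <= n ->
  (forall A B, maximal_pair r A B -> #|A| * #|B| <= bound r p /\ Q A B) ->
  forall A B, r_cross_intersecting r A B ->
    #|A| * #|B| <= bound r p /\ (#|A| * #|B| = bound r p -> Q A B).
Proof.
move=> Ppos rn h A B hc.
have [A0 [B0 hm0]] := maximal_exists p r; have [le0 _] := h _ _ hm0.
have max (C D : {set Sp p}) : r_cross_intersecting r C D -> #|C| * #|D| <= bound r p.
  by move=> hCD; apply: leq_trans le0; apply: (proj2 hm0).
split=> [|e]; first exact: max.
by have [] := h A B; [split=> // C D hCD; rewrite e; apply: max | ].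
Qed.

Lemma maximal_fixed r A B T : (forall i, 1 < P i) -> sorted leq p -> 0 < r ->
  r_cross_intersecting r A B -> 0 < #|A| -> 0 < #|B| ->
  depends_on T A -> depends_on T B -> #|T| <= r ->
  #|A| * #|B| <= bound r p /\ A = B /\ fixes_coords r A.
Proof.
move=> P2 sp r0 hc A0 B0 dA dB Tr.
have [Te [c [eA eB]]] := cross_fixed P2 hc A0 B0 dA dB Tr.
split; first by rewrite eA eB card_fix_on mulnn; apply: prod_outside_sq_le.
by split; [rewrite eA eB | exists T, c].
Qed.

Lemma maximal_large r A B : 0 < r -> r <= n -> sorted leq p ->
  (forall i, r.+2 <= P i) -> maximal_pair r A B ->
  #|A| * #|B| <= bound r p /\ A = B /\ fixes_coords r A.
Proof.
move=> r0 rn sp hq hm.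
have P3 i : 2 < P i by have := hq i; lia.
have P2 i : 1 < P i by apply: ltnW.
have P1 i : 0 < P i by apply: ltnW.
have [A0 B0] := maximal_gt0 P1 rn hm.
have [T [c [bA bB dA dB]]] := maximal_structure rn P3 hm.
apply: (maximal_fixed P2 sp r0 (proj1 hm) A0 B0 dA dB).
exact: (tight_bound P1 P2 hm r0 A0 B0 dA dB bA bB hq).
Qed.

Lemma maximal_hamming r A B q : r <= n -> (forall i, q <= P i) -> 3 < q ->
  2 * (r + 3) <= (2 * q - (r + 3)) * q -> maximal_pair r A B ->
  exists T c d, [/\ #|T| = r + d, d <= 2,
    [/\ biased A T c, biased B T c, depends_on T A & depends_on T B] &
    [\/ A = hamming_ball c T d /\ B = hamming_ball c T 0,
        A = hamming_ball c T 0 /\ B = hamming_ball c T d |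
        [/\ d = 2, A = hamming_ball c T 1 & B = hamming_ball c T 1]]].
Proof.
move=> rn hq q3 num hm.
have P3 i : 2 < P i by have := hq i; lia.
have P2 i : 1 < P i by apply: ltnW.
have P1 i : 0 < P i by apply: ltnW.
have [A0 B0] := maximal_gt0 P1 rn hm.
have [T [c [bA bB dA dB]]] := maximal_structure rn P3 hm.
have Tr := few_relevant P1 hm bA bB hq num.
have rT : r <= #|T|.
  have /card_gt0P[x xA] := A0; have /card_gt0P[y yB] := B0.
  have := cross_on P2 (proj1 hm) dA xA yB; lia.
exists T, c, (#|T| - r); have Te : #|T| = r + (#|T| - r) by rewrite subnKC.
have d2 : #|T| - r <= 2 by rewrite leq_subLR.
split=> //; apply: (ball_structure P2 hm A0 B0 dA dB bA bB (fun i _ => hq i) Te d2).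
by apply: leq_ltn_trans q3; rewrite ltnS.
Qed.

Lemma prod_outsideD1 T j : j \in T ->
  \prod_(i | i \notin T :\ j) P i = P j * \prod_(i | i \notin T) P i.
Proof.
move=> jT; rewrite (bigD1 j) /=; last by rewrite !inE eqxx.
congr (_ * _); apply: eq_bigl => i; rewrite !inE negb_and negbK.
by have [->|ij] := eqVneq i j; rewrite ?jT // andbT.
Qed.

(** For [P j] largest on [T], [lower_on] and the size of a ball of radius 1 give
    [P j ^ 2 <= 1 + (r + 1) * (P j).-1], which forces [P j <= r]. *)
Lemma no_point_pair1 r A B T c : 0 < r -> (forall i, r.+1 <= P i) -> maximal_pair r A B ->
  #|T| = r + 1 -> A = hamming_ball c T 1 -> B = hamming_ball c T 0 -> False.
Proof.
move=> r0 hq hm Tr eA eB.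
have P1 i : 0 < P i by apply: leq_trans (hq i).
have [j0 j0T] : exists j, j \in T by apply/card_gt0P; rewrite Tr addn1.
have [j jT hj] := arg_maxnP (fun i => P i) j0T.
have := lower_on P1 hm Tr jT (fun i _ => hq i).
rewrite expn0 muln1 eB hamming_ball0 card_fix_on -mulnn.
have F0 := prod_outside_gt0 P1 T; set F := \prod_(i | _) _ in F0 *.
have -> : F * P j * (F * P j) = F * (P j * P j) * F by ring.
rewrite leq_pmul2r //.
have leA : #|A| <= F * (1 + #|T| * (P j).-1).
  rewrite eA; apply: leq_trans (card_supp_le1 _ _) _.
  by rewrite leq_mul2l leq_add2l sum_pred_le ?orbT.
move=> h; have {h} := leq_trans h leA; rewrite leq_pmul2l // Tr.
by have := hq j; case: (P j) => [|m] //=; nia.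
Qed.

(** Bounding [A] through its bias avoids counting a ball of radius 2: [lower_on] and [biased_upper]
    give [r * r.+1 * P j ^ 2 <= 2 * (1 + (r + 2) * (P j).-1)], impossible for [P j >= r.+1]. *)
Lemma no_point_pair2 r A B T c : 3 < r -> (forall i, r.+1 <= P i) -> maximal_pair r A B ->
  #|T| = r + 2 -> biased A T c -> B = hamming_ball c T 0 -> False.
Proof.
move=> r4 hq hm Tr bA eB.
have P1 i : 0 < P i by apply: leq_trans (hq i).
have [j0 j0T] : exists j, j \in T by apply/card_gt0P; rewrite Tr addn2.
have [j jT hj] := arg_maxnP (fun i => P i) j0T.
have hqT i : i \in T -> r.+1 <= P i <= P j by move=> /hj ij; rewrite hq.
have := lower_on P1 hm Tr jT (fun i _ => hq i).
have := biased_upper bA hqT.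
rewrite expn1 eB hamming_ball0 card_fix_on -mulnn.
have F0 := prod_outside_gt0 P1 T; set F := \prod_(i | _) _ in F0 *.
move=> up lo; rewrite Tr in up.
have {}lo : F * (P j * r.+1) * (P j * r.+1) <= #|A|.
  by rewrite -(leq_pmul2r F0); apply: leq_trans lo; apply: eq_leq; ring.
have qj := hq j; have Dr : 2 * r.+1 - (r + 2) = r by lia.
rewrite Dr in up.
have : r * (F * (P j * r.+1) * (P j * r.+1)) <= 2 * r.+1 * (F * (1 + (r + 2) * (P j).-1)).
  by apply: leq_trans up; rewrite leq_mul2l lo orbT.
have -> : r * (F * (P j * r.+1) * (P j * r.+1)) = (r.+1 * F) * (r * P j * (P j * r.+1)) by ring.
have -> : 2 * r.+1 * (F * (1 + (r + 2) * (P j).-1)) =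
  (r.+1 * F) * (2 * (1 + (r + 2) * (P j).-1)) by ring.
rewrite leq_pmul2l ?muln_gt0 ?F0 //; case: (P j) qj => [|m] //= rm.
nia.
Qed.

Lemma maximal_critical r A B : 3 < r -> r <= n -> sorted leq p ->
  (forall i, r.+1 <= P i) -> maximal_pair r A B ->
  #|A| * #|B| <= bound r p /\ A = B /\
  (fixes_coords r A \/ exists (T : {set 'I_n}) (x0 : Sp p),
    #|T| = r.+2 /\ (forall i, i \in T -> P i = r.+1) /\ A = hamming_ball x0 T 1).
Proof.
move=> r4 rn sp hq hm; have r0 : 0 < r by apply: leq_trans r4.
have P2 i : 1 < P i by have := hq i; lia.
have P1 i : 0 < P i by apply: ltnW.
have [A0 B0] := maximal_gt0 P1 rn hm; have hm' := maximal_sym hm.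
(* This reads [2 * (r + 3) <= (r - 1) * (r + 1)], which holds from [r = 4] on. *)
have num : 2 * (r + 3) <= (2 * r.+1 - (r + 3)) * r.+1.
  have -> : 2 * r.+1 - (r + 3) = r.-1 by lia.
  nia.
have [T [c [d [Td d2 [bA bB dA dB] hAB]]]] := maximal_hamming rn hq (leqW r4) num hm.
have [dz|d0] := posnP d.
  have Tr : #|T| <= r by rewrite Td dz addn0.
  have [h1 [h2 h3]] := maximal_fixed P2 sp r0 (proj1 hm) A0 B0 dA dB Tr.
  by split=> //; split=> //; left.
case: d d0 d2 Td hAB => [//|[|[|//]]] _ _ Td hAB.
  exfalso; case: hAB => [[eA eB]|[eA eB]|[//]].
    exact: no_point_pair1 r0 hq hm Td eA eB.
  exact: no_point_pair1 r0 hq hm' Td eB eA.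
case: hAB => [[_ eB]|[eA _]|[_ eA eB]].
- by case: (no_point_pair2 r4 hq hm Td bA eB).
- by case: (no_point_pair2 r4 hq hm' Td bB eA).
(* Both families are now the same ball of radius 1. With [j], [k] of the two largest sizes in [T],
   fixing the other [r] coordinates gives [P j * P k <= P j + r.+1 * (P k).-1], so [P j <= r.+1]. *)
have eAB : B = A by rewrite eA eB.
have [j0 j0T] : exists j, j \in T by apply/card_gt0P; rewrite Td addn2.
have [j jT hj] := arg_maxnP (fun i => P i) j0T.
have Tj : #|T :\ j| = r.+1 by apply: card_setD1 jT _; rewrite Td addn2.
have [k0 k0T] : exists k, k \in T :\ j by apply/card_gt0P; rewrite Tj.
have [k kT hk] := arg_maxnP (fun i => P i) k0T.
have Tk : #|T :\ j :\ k| = r by apply: card_setD1 kT Tj.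
have := maximal_lower P1 hm Tk.
have F0 := prod_outside_gt0 P1 T.
have leA : #|A| <= (\prod_(i | i \notin T) P i) * (1 + \sum_(i in T) (P i).-1).
  by rewrite eA; apply: card_supp_le1.
have := prod_outside_sq_le sp r0 Tk.
rewrite eAB mulnn leq_exp2r // prod_outsideD1 // prod_outsideD1 //.
set F := \prod_(i | _) _ in F0 leA * => hbound hlow.
have sumT : \sum_(i in T) (P i).-1 <= (P j).-1 + r.+1 * (P k).-1.
  rewrite (big_setD1 j jT) /= leq_add2l -Tj; apply: sum_pred_le => i iT.
  exact: hk.
have qj := hq j; have qk := hq k.
have ej : P j = r.+1.
  have h := leq_trans hlow leA.
  rewrite mulnA mulnC leq_pmul2l // in h.
  have {}h := leq_trans h (_ : _ <= 1 + ((P j).-1 + r.+1 * (P k).-1)).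
  by rewrite leq_add2l in h; have := h sumT; nia.
have eT i : i \in T -> P i = r.+1.
  move=> iT; have ij : P i <= P j := hj i iT.
  by apply/eqP; rewrite eqn_leq hq -ej ij.
have ek : P k = r.+1 by apply: eT; case/setD1P: kT.
split; last first.
  by split=> //; right; exists T, c; rewrite Td addn2.
(* The ball has at most [F * (1 + (r + 2) * r) = F * r.+1 ^ 2] elements, as many as fixing [r]
   coordinates of [T] leaves. *)
apply: leq_trans hbound; rewrite leq_exp2r //.
apply: leq_trans leA _; rewrite mulnA mulnC leq_mul2r; apply/orP; right.
rewrite ej ek in sumT *; nia.
Qed.

End ExtremalPairs.

(** * The threshold function and the assembly of the three parts *)

Lemma nth0_le (p : seq nat) (i : 'I_(size p)) : sorted leq p -> nth 0 p 0 <= nth 0 p i.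
Proof.
by case: p i => [[]|a s] //= i sp; apply: (@sorted_nth_le (a :: s) ord0 i).
Qed.

(** The difference is the constant [a / 2], so any [N] above [|a / 2| / eps] works. *)
Lemma threshold_asymptotics (a eps : rat) : (0 < eps)%R ->
  exists N : nat, forall r : nat, N <= r ->
    (`|(r%:R + a) / 2 - r%:R / 2| <= eps * r%:R)%R.
Proof.
move=> e0; exists (Num.bound (`|a / 2| / eps)%R) => r Nr.
rewrite mulrDl addrAC subrr add0r [leRHS]mulrC -ler_pdivrMr //.
apply: ltW; apply: lt_le_trans (archi_boundP _) _; first by rewrite divr_ge0 // ltW.
by rewrite ler_nat.
Qed.

Theorem theorem7 :
  (* (1) *)
  (forall (r : nat) (p : seq nat) (A B : {set Sp p}),
      1 <= r -> r <= size p -> size_vector p -> sorted leq p ->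
      r_cross_intersecting r A B ->
      r.+1 < nth 0 p 0 ->
      #|A| * #|B| <= bound r p /\
      (#|A| * #|B| = bound r p -> A = B /\ fixes_coords r A)) /\
  (* (2) *)
  (forall (r : nat) (p : seq nat) (A B : {set Sp p}),
      1 <= r -> r <= size p -> size_vector p -> sorted leq p ->
      r_cross_intersecting r A B ->
      nth 0 p 0 = r.+1 -> 4 < r.+1 ->
      #|A| * #|B| <= bound r p /\
      (#|A| * #|B| = bound r p ->
        A = B /\
        (fixes_coords r A \/
         exists (T : {set 'I_(size p)}) (x0 : Sp p),
           #|T| = r.+2 /\ (forall i, i \in T -> nth 0 p i = r.+1) /\
           A = hamming_ball x0 T 1))) /\
  (* (3) *)
  (exists t : nat -> rat,
      (forall eps : rat, 0 < eps -> exists N : nat, forall r : nat, (N <= r)%N ->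
         `|t r - r%:R / 2| <= eps * r%:R)%R /\
      (forall (r : nat) (p : seq nat) (A B : {set Sp p}),
         1 <= r -> r <= size p -> size_vector p -> sorted leq p ->
         (t r <= (nth 0%N p 0)%:R)%R ->
         maximal_pair r A B ->
         exists (T : {set 'I_(size p)}) (x0 y0 : Sp p) (k l : nat),
           #|T| <= r + 3 /\ k <= #|T| /\ l <= #|T| /\
           A = hamming_ball x0 T k /\ B = hamming_ball y0 T l)).
Proof.
split; [|split].
- move=> r p A B r1 rn sv sp hc p0.
  have hq (i : 'I_(size p)) : r.+2 <= nth 0 p i by apply: leq_trans (nth0_le i sp).
  apply: (reduce_to_maximal (Q := fun A B => A = B /\ fixes_coords r A)) => //.
    by move=> i; apply: leq_trans (hq i).
  by move=> C D; apply: maximal_large.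
- move=> r p A B r1 rn sv sp hc p0 r4.
  have hq (i : 'I_(size p)) : r.+1 <= nth 0 p i by rewrite -p0 nth0_le.
  apply: (reduce_to_maximal (Q := fun A B => A = B /\ (fixes_coords r A \/ 
    exists (T : {set 'I_(size p)}) (x0 : Sp p), #|T| = r.+2 /\
    (forall i, i \in T -> nth 0 p i = r.+1) /\ A = hamming_ball x0 T 1))) => //.
    by move=> i; apply: leq_trans (hq i).
  by move=> C D; apply: maximal_critical.
(* From [2 * p_1 >= r + 7] and [r >= 1] come [p_1 > 3] and [2 * p_1 - (r + 3) >= 4]; the condition
   of [maximal_hamming] then follows from [4 * p_1 >= 2 * (r + 7)]. *)
exists (fun r => (r%:R + 7) / 2)%R; split=> [eps|r p A B r1 rn sv sp].
  exact: threshold_asymptotics.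
rewrite ler_pdivrMr // -!natrD -natrM ler_nat => tp hm.
have q3 : 3 < nth 0 p 0 by lia.
have num : 2 * (r + 3) <= (2 * nth 0 p 0 - (r + 3)) * nth 0 p 0.
  by apply: (@leq_trans (4 * nth 0 p 0)); [lia | rewrite leq_mul2r; lia].
have [T [c [d [Td d2 _ hAB]]]] :=
  maximal_hamming rn (fun i => nth0_le i sp) q3 num hm.
have dT : d <= #|T| by rewrite Td leq_addl.
have T3 : #|T| <= r + 3 by rewrite Td leq_add2l ltnW.
case: hAB => [[eA eB]|[eA eB]|[e2 eA eB]].
- by exists T, c, c, d, 0.
- by exists T, c, c, 0, d.
- by exists T, c, c, 1, 1; do !split=> //; apply: leq_trans dT; rewrite e2.
Qed.
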